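(* Assume that $\mathbb{E}S_N<0$. Then, for every $s\in\mathbb{C}$ such that $|s|<1$, $s\neq 0$ and $G_{S_N}(s)\neq 1$, $$\frac{\boldsymbol{G}_{\mathcal M}(s)}{1-s}=\frac{\boldsymbol{M}(s)\,\boldsymbol{B}(s)}{G_{S_N}(s)-1},$$ where $\boldsymbol{G}_{\mathcal M}(s)=(G_{\mathcal M_1}(s),\ldots,G_{\mathcal M_N}(s))^T$.
   Context: Let $N\in\mathbb N$ and let $X_1,X_2,\ldots$ be independent integer-valued random variables that are $N$-periodic in distribution: $X_k$ and $X_{k+N}$ have the same distribution for all $k\in\mathbb N$. For $j=1,\ldots,N$ the support of $X_j$ starts at $m_j\in\mathbb Z$, i.e. $\mathbb P(X_j=m_j)>0$ and $\mathbb P(X_j\ge m_j)=1$, and $D:=m_1+\cdots+m_N<0$ (the individual $m_j$ may have any sign). Put $S_N:=X_1+\cdots+X_N$ and $F_{X_j}(k):=\mathbb P(X_j\le k)$. For $j=1,\ldots,N$ let $\mathcal M_j:=\max\{0,\,X_j,\,X_j+X_{j+1},\,X_j+X_{j+1}+X_{j+2},\ldots\}$ (supremum over all partial sums started at index $j$) and $\pi^{(j)}_k:=\mathbb P(\mathcal M_j=k)$, $k\in\mathbb N_0=\{0,1,2,\ldots\}$, with the convention $\pi^{(N+1)}=\pi^{(1)}$. For an integer-valued random variable $X$ with $\mathbb P(m\le X<\infty)=1$, its probability generating function is $G_X(s)=\sum_{k=m}^\infty s^k\,\mathbb P(X=k)$ for $s\in\mathbb C$, $|s|\le 1$, and $s\ne0$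 if $m<0$. $\boldsymbol B(s)=(B_1(s),\ldots,B_N(s))^T$ with $$B_j(s):=\sum_{k=m_j}^{-1}s^k\sum_{i=0}^{k-m_j}\pi^{(j+1)}_iF_{X_j}(k-i)$$ (empty sums are $0$, so $B_j=0$ if $m_j\ge0$). $\boldsymbol M(s)$ is the $N\times N$ matrix with $(j,r)$ entry $1$ if $j=r$; $G_{X_j+X_{j+1}+\cdots+X_{r-1}}(s)$ if $j<r$; and $G_{X_1+\cdots+X_{r-1}+X_j+X_{j+1}+\cdots+X_N}(s)$ if $j>r$ (where for $r=1$ the part $X_1+\cdots+X_{r-1}$ is absent). *)

(* Defs.v *)
From HB Require Import structures.
From mathcomp Require Import all_boot all_order all_algebra finmap.
From mathcomp Require Import all_classical all_reals all_analysis.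
From mathcomp Require Import complex.

Set Implicit Arguments.
Unset Strict Implicit.
Unset Printing Implicit Defensive.

Import Order.TTheory GRing.Theory Num.Theory.
Import numFieldNormedType.Exports.

Local Open Scope classical_set_scope.
Local Open Scope ring_scope.
Local Open Scope complex_scope.

(* Indices are shifted down by one with respect to the usual X_1, X_2, ...:
   the variable X_(k+1) is [X k], and j = 1, ..., N becomes j : 'I_N. *)

(* The integers a, a+1, ..., b-1 (none if b <= a). *)
Definition int_range (a b : int) : seq int :=
  [seq a + i%:Z | i <- iota 0 (absz (Num.max 0 (b - a)))].

Section RandomVariables.
Context (d : measure_display) (T : measurableType d) (R : realType)
  (P : probability T R).

Definition mutually_independent (X : nat -> {RV P >-> R}) : Prop :=
  forall (J : {fset nat}) (A : nat -> set R),
    (forall i, i \in J -> measurable (A i)) ->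
    P (\bigcap_(i in [set` J]) (X i @^-1` A i)) =
    (\prod_(i <- J) P (X i @^-1` A i))%E.

Definition int_pmf (Y : T -> \bar R) (k : int) : R :=
  fine (P [set w | Y w = (k%:~R)%:E]).

(* G_Y(s) for Y integer-valued with Y >= m almost surely.
   R[i] carries its norm topology only under the alias R[i]^o. *)
Definition pgf (m : int) (Y : T -> \bar R) (s : R[i]) : R[i] :=
  limn (series (fun n : nat => s ^ (m + n%:Z) * (int_pmf Y (m + n%:Z))%:C)
        : nat -> R[i]^o).

End RandomVariables.

Section PeriodicWalk.
Context (d : measure_display) (T : measurableType d) (R : realType)
  (P : probability T R).
Context (N : nat) (X : nat -> {RV P >-> R}) (m : 'I_N -> int).

(* The empty partial sum (n = 0) contributes the value 0 to the supremum,
   which is +oo when the partial sums are unbounded. *)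
Definition walk_max (j : nat) (w : T) : \bar R :=
  ereal_sup (range (fun n : nat => (\sum_(j <= i < j + n) X i w)%:E)).

Definition pi_ (j : nat) (k : nat) : R := int_pmf P (walk_max j) k%:Z.

Definition period_sum (A : pred 'I_N) (w : T) : R :=
  \sum_(i < N | A i) X i w.

Definition G_period_sum (A : pred 'I_N) (s : R[i]) : R[i] :=
  pgf P (\sum_(i < N | A i) m i) (EFin \o period_sum A) s.

Definition G_S (s : R[i]) : R[i] := G_period_sum predT s.

Definition G_max (s : R[i]) : 'cV[R[i]]_N :=
  \col_(j < N) pgf P 0 (walk_max j) s.

(* [ordS j] is the cyclic successor of j, i.e. pi^(N+1) = pi^(1). *)
Definition B_vec (s : R[i]) : 'cV[R[i]]_N :=
  \col_(j < N) \sum_(k <- int_range (m j) 0)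
    s ^ k * (\sum_(0 <= i < (absz (k - m j)).+1)
               pi_ (ordS j) i * fine (cdf (X j) (k - i%:Z)%:~R))%:C.

(* When j > r the two index blocks [0, r) and [j, N) are disjoint, so their
   union gives the sum X_1 + ... + X_(r-1) + X_j + ... + X_N. *)
Definition M_mx (s : R[i]) : 'M[R[i]]_N :=
  \matrix_(j < N, r < N)
    if j == r then 1
    else if (j < r)%N then G_period_sum (fun i : 'I_N => (j <= i < r)%N) s
    else G_period_sum (fun i : 'I_N => (i < r)%N || (j <= i)%N) s.

End PeriodicWalk.

(* Main.v *)
Require Import Defs.
From HB Require Import structures.
From mathcomp Require Import all_boot all_order all_algebra finmap.
From mathcomp Require Import all_classical all_reals all_analysis.
From mathcomp Require Import measurable_realfun complex zify ring.

Set Implicit Arguments.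
Unset Strict Implicit.
Unset Printing Implicit Defensive.

Import Order.TTheory GRing.Theory Num.Theory.
Import numFieldNormedType.Exports.

Local Open Scope classical_set_scope.
Local Open Scope ring_scope.
Local Open Scope complex_scope.

(* Pathwise M_j = max(0, M_(j+1) + X_j) with X_j independent of M_(j+1), so
     G_(M_j)(s) = G_(X_j)(s) G_(M_(j+1))(s)
                  + sum_(k < 0) (1 - s^k) P(M_(j+1) + X_j = k),
   and summation by parts turns the last sum into (s - 1) B_j(s).  Periodicity
   in distribution closes this recurrence up after N steps; going once around
   the cycle gives (1 - G_(S_N)(s)) G_(M_j)(s) = (s - 1) (M(s) B(s))_j. *)

(** Two obstacles shape the proof. M_(j+1) depends on infinitely many variables, whereas
    [mutually_independent] and periodicity speak of finitely many at a time; both are therefore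
    transported from cylinder events to the whole sequence sigma-algebra by a pi-lambda argument.
    This gives the independence of X_j from M_(j+1), and the equality of the laws of the maxima
    started at N and at 0. Secondly, [walk_max] may take the value +oo, which the coefficients of
    [pgf] do not see. All power series are thus treated with nonnegative coefficients of sum at most
    1, which is enough for convergence in the open unit disc and for the product formula. The inner
    sum of B_j at k is P(M_(j+1) + X_j <= k), written as the convolution of the law of M_(j+1) with
    the distribution function of X_j. Such cumulative sums are what summation by parts produces from
    the point masses P(M_(j+1) + X_j = k). *)

(* Stated over an abstract field: on [R[i]^o] the unifier gets lost in the
   many structures of [R[i]]. *)
Lemma cvg_mulB (K : numFieldType) (f g h : nat -> K) (a b c : K) :
  (f : nat -> K^o) @ \oo --> (a : K^o) ->
  (g : nat -> K^o) @ \oo --> (b : K^o) ->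
  (h : nat -> K^o) @ \oo --> (c : K^o) ->
  ((fun n => f n * g n - h n) : nat -> K^o) @ \oo --> ((a * b - c) : K^o).
Proof. by move=> fa gb hc; apply: (@cvgB _ K^o) => //; exact: (@cvgM K). Qed.

Lemma is_cvgn_mull (K : numFieldType) (f : nat -> K) (k : K) :
  cvgn (f : nat -> K^o) -> cvgn ((fun n => k * f n) : nat -> K^o).
Proof.
move=> fa; apply/cvg_ex; exists (k * limn (f : nat -> K^o)).
by apply: (@cvgM K) => //; exact: cvg_cst.
Qed.

Lemma limn_mull (K : numFieldType) (f : nat -> K) (k : K) :
  cvgn (f : nat -> K^o) ->
  limn ((fun n => k * f n) : nat -> K^o) = k * limn (f : nat -> K^o).
Proof.
move=> fa; apply: (@cvg_lim K^o) => //.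
by apply: (@cvgM K) => //; exact: cvg_cst.
Qed.

(** * Power series with subprobability coefficients in the open unit disc *)

Section PowerSeries.
Context (R : realType).
Implicit Types (z l s : R[i]) (u v : nat -> R[i]^o) (a b p : nat -> R).

(** The norm of [R[i]] takes its values in [R[i]]; the real-valued version gives access to order and
    squeeze arguments in [R]. *)
Definition cmod z : R := complex.Re `|z|.

Lemma cmodE z : `|z| = (cmod z)%:C.
Proof. by rewrite /cmod RRe_real// ger0_real. Qed.

Lemma cmod_ge0 z : 0 <= cmod z.
Proof. by rewrite -lecR -cmodE normr_ge0. Qed.

Lemma ler_cmod_Re_Im z : cmod z <= `|complex.Re z| + `|complex.Im z|.
Proof.
rewrite -lecR -cmodE [z in `|z|]complexE rmorphD /=.
apply: (le_trans (ler_normD _ _)); rewrite lerD// ?normrM !normc_def /=.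
  by rewrite expr0n addr0 sqrtr_sqr.
by rewrite !expr0n /= expr1n add0r addr0 sqrtr1 mul1r sqrtr_sqr.
Qed.

Lemma cvg_cmodP u l :
  (u @ \oo --> (l : R[i]^o)) <-> ((fun n => cmod (l - u n)) @ \oo --> (0 : R)).
Proof.
split=> [/cvgrPdist_lt ul | /cvgr0Pnorm_lt ul].
- apply/cvgr0Pnorm_lt => e e0.
  have /ul : 0 < e%:C by rewrite ltcR.
  by apply: filterS => n; rewrite cmodE ltcR ger0_norm ?cmod_ge0.
- apply/cvgrPdist_lt => e e0.
  have eE : e = (complex.Re e)%:C by rewrite RRe_real// gtr0_real.
  rewrite eE ltcR in e0; have := ul _ e0; rewrite eE.
  by apply: filterS => n; rewrite cmodE ltcR ger0_norm ?cmod_ge0.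
Qed.

Lemma is_cvg_complex u :
  cvgn (fun n => complex.Re (u n)) -> cvgn (fun n => complex.Im (u n)) ->
  cvgn u.
Proof.
move=> /cvg_ex[/= x ux] /cvg_ex[/= y uy]; apply/cvg_ex; exists (x +i* y).
apply/cvg_cmodP.
apply: (@squeeze_cvgr _ _ _ _ (fun=> 0)
  (fun n => `|x - complex.Re (u n)| + `|y - complex.Im (u n)|)).
- near=> n; rewrite cmod_ge0 /=; apply: (le_trans (ler_cmod_Re_Im _)).
  by case: (u n) => c e.
- exact: cvg_cst.
- rewrite -[X in _ --> X]addr0; apply: cvgD.
    by apply/norm_cvg0P; rewrite -(subrr x); apply: cvgB => //; exact: cvg_cst.
  by apply/norm_cvg0P; rewrite -(subrr y); apply: cvgB => //; exact: cvg_cst.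
Unshelve. all: by end_near. Qed.

Definition psum s p : R[i] :=
  limn (series (fun n => s ^+ n * (p n)%:C) : nat -> R[i]^o).

(** The total mass may be below 1, the deficit being what sits at +oo. *)
Definition subprob p :=
  (forall n, 0 <= p n) /\ (forall n, \sum_(i < n) p i <= 1).

Lemma is_cvg_subprob p : subprob p -> cvgn (series p).
Proof.
case=> p0 p1; apply: nondecreasing_is_cvgn.
  by apply/nondecreasing_seqP => n; rewrite seriesSr lerDl.
by exists 1 => _ [n _ <-]; rewrite seriesEord; exact: p1.
Qed.

(** The real and imaginary parts of [s ^+ n] are bounded by 1, so both real series are dominated by
    the convergent series of [p]. *)
Lemma is_cvg_psum s p : `|s| < 1 -> subprob p ->
  cvgn (series (fun n => s ^+ n * (p n)%:C) : nat -> R[i]^o).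
Proof.
move=> s1 hp.
have sn n : `|s ^+ n| <= 1.
  by rewrite normrX; apply: exprn_ile1 => //; exact: ltW.
have key f : (forall n, `|f n| <= 1) -> cvgn (series (fun n => f n * p n : R)).
  move=> f1; apply: normed_cvg.
  apply: (series_le_cvg _ _ _ (is_cvg_subprob hp)) => n /=.
  - exact: normr_ge0.
  - exact: hp.1.
  - by rewrite normrM (ger0_norm (hp.1 n)) ler_piMl// hp.1.
apply: is_cvg_complex.
- rewrite [X in cvgn X](_ : _ =
      series (fun n => complex.Re (s ^+ n) * p n)); last first.
    apply/funext => n; rewrite /series /= raddf_sum.
    by apply: eq_bigr => i _; case: (s ^+ i) => x y /=; rewrite mulr0 subr0.
  apply: key => n; rewrite -lecR; apply: le_trans (sn n).
  exact: normc_ge_Re.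
- rewrite [X in cvgn X](_ : _ =
      series (fun n => complex.Im (s ^+ n) * p n)); last first.
    apply/funext => n; rewrite /series /= raddf_sum.
    by apply: eq_bigr => i _; case: (s ^+ i) => x y /=; rewrite mulr0 add0r.
  apply: key => n; rewrite -lecR; apply: le_trans (sn n).
  (* The bound on the imaginary part is the one on the real part after multiplication by i, which
     has modulus 1. *)
  have := normc_ge_Re (s ^+ n * 'i%C); rewrite ReiNIm normrN normrM.
  have -> : `|'i%C : R[i]| = 1.
    by rewrite normc_def /= expr0n add0r expr1n sqrtr1.
  by rewrite mulr1.
Qed.

Definition conv a b n : R := \sum_(i < n.+1) a i * b (n - i)%N.

Lemma conv_coef K a b n : (n < K)%N ->
  (\poly_(i < K) a i * \poly_(i < K) b i)`_n = conv a b n.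
Proof.
move=> nK; rewrite coefM; apply: eq_bigr => i _; rewrite !coef_poly.
rewrite (leq_ltn_trans _ nK) ?(leq_ltn_trans _ nK)// ?leq_subr//.
by rewrite -ltnS.
Qed.

(* The error consists of the terms of degree >= K of a product of two
   truncations; its coefficients are nonnegative with sum at most 1. *)
Lemma psum_cauchy_err s a b K : `|s| < 1 -> subprob a -> subprob b ->
  cmod (series (fun n => s ^+ n * (a n)%:C) K *
        series (fun n => s ^+ n * (b n)%:C) K -
        series (fun n => s ^+ n * (conv a b n)%:C) K) <= cmod s ^+ K.
Proof.
move=> s1 [a0 a1] [b0 b1].
set pa := \poly_(i < K) a i; set pb := \poly_(i < K) b i.
have evC p : series (fun n => s ^+ n * (p n)%:C) K
    = (map_poly (real_complex R) (\poly_(i < K) p i)).[s].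
  rewrite (@horner_coef_wide _ K); last by rewrite size_map_poly size_poly.
  rewrite seriesEord /=; apply: eq_bigr => i _.
  by rewrite coef_map coef_poly ltn_ord mulrC.
have ev1 p : (forall n, 0 <= p n) -> (forall n, \sum_(i < n) p i <= 1) ->
    0 <= (\poly_(i < K) p i).[1] <= 1.
  move=> p0 p1; rewrite (@horner_coef_wide _ K) ?size_poly//.
  under eq_bigr => i _ do rewrite coef_poly ltn_ord expr1n mulr1.
  by rewrite p1 sumr_ge0.
rewrite !evC -hornerM -rmorphM /= -/pa -/pb.
rewrite (@horner_coef_wide _ (K + K)); last first.
  rewrite size_map_poly (leq_trans (size_polyMleq _ _))//.
  by rewrite (leq_trans (leq_pred _))// leq_add// size_poly.
rewrite big_split_ord /= (@horner_coef_wide _ K); last first.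
  by rewrite size_map_poly size_poly.
rewrite (_ : \sum_(i < K) _ = \sum_(i < K)
   (map_poly (real_complex R) (\poly_(j < K) conv a b j))`_i * s ^+ i);
  last first.
  apply: eq_bigr => i _; rewrite !coef_map coef_poly ltn_ord.
  by rewrite conv_coef.
rewrite addrAC subrr add0r.
rewrite -lecR -cmodE rmorphXn /= -cmodE.
apply: (le_trans (ler_norm_sum _ _ _)).
have d0 i : 0 <= (pa * pb)`_i.
  rewrite coefM sumr_ge0// => j _; rewrite !coef_poly.
  by apply: mulr_ge0; case: ifP.
apply: (@le_trans _ _ (\sum_(i < K) (((pa * pb)`_(K + i))%:C * `|s| ^+ K))).
  apply: ler_sum => i _; rewrite coef_map normrM normrX exprD.
  rewrite ger0_norm; last by rewrite ler0c.
  apply: ler_wpM2l; first by rewrite ler0c.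
  by rewrite ler_piMr ?exprn_ge0//; apply: exprn_ile1 => //; exact: ltW.
rewrite -mulr_suml ler_piMl ?exprn_ge0//.
have : (pa * pb).[1] <= 1.
  rewrite hornerM.
  have /andP[x0 x1] := ev1 _ a0 a1; have /andP[y0 y1] := ev1 _ b0 b1.
  by rewrite mulr_ile1.
rewrite (@horner_coef_wide _ (K + K)); last first.
  rewrite (leq_trans (size_polyMleq _ _))//.
  by rewrite (leq_trans (leq_pred _))// leq_add// size_poly.
under eq_bigr => i _ do rewrite expr1n mulr1.
rewrite big_split_ord /= => h; rewrite -rmorph_sum lecR /=.
by apply: le_trans h; rewrite lerDr sumr_ge0.
Qed.

Lemma psum_conv s a b : `|s| < 1 ->
  subprob a -> subprob b -> subprob (conv a b) ->
  psum s (conv a b) = psum s a * psum s b.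
Proof.
move=> s1 ha hb hc.
have ca := is_cvg_psum s1 ha; have cb := is_cvg_psum s1 hb.
have cc := is_cvg_psum s1 hc.
apply/eqP; rewrite eq_sym -subr_eq0; apply/eqP.
pose S p K : R[i] := series (fun n => s ^+ n * (p n)%:C) K.
pose f K := S a K * S b K - S (conv a b) K.
have cf : (f : nat -> R[i]^o) @ \oo -->
    (psum s a * psum s b - psum s (conv a b) : R[i]^o).
  have := cvg_mulB ca cb cc.
  exact.
have f0 : (f : nat -> R[i]^o) @ \oo --> (0 : R[i]^o).
  apply/cvg_cmodP.
  apply: (@squeeze_cvgr _ _ _ _ (fun=> 0) (fun n => cmod s ^+ n)).
  - near=> n; rewrite cmod_ge0 /= sub0r.
    rewrite -lecR -cmodE normrN cmodE lecR.
    exact: psum_cauchy_err.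
  - exact: cvg_cst.
  - by apply: cvg_expr; rewrite ger0_norm ?cmod_ge0// -ltcR -cmodE.
exact: (cvg_unique _ cf f0).
Unshelve. all: by end_near. Qed.

End PowerSeries.

(** * The sigma-algebra of sequences: independence and stationarity beyond finitely many indices *)

Section SequenceSpace.
Context (R : realType).

(** The underlying space is always the full sequence space; only the sigma-algebra generated by the
    cylinders varies with [K]. Measurability with respect to it expresses dependence on the
    coordinates in [K] alone. *)
Definition cylinder (K : set nat) : set (set (nat -> R)) :=
  [set C | exists (J : {fset nat}) (A : nat -> set R),
    [/\ [set` J] `<=` K, forall i, measurable (A i) &
        C = [set x | forall i, i \in J -> A i (x i)]]].

Lemma setI_closed_cylinder K : setI_closed (cylinder K).
Proof.
move=> _ _ [J1 [A1 [J1K mA1 ->]]] [J2 [A2 [J2K mA2 ->]]].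
(* Padding with [setT] outside the index set lets the two families of constraints be intersected
   index by index. *)
pose A (J : {fset nat}) (A0 : nat -> set R) i := if i \in J then A0 i else setT.
exists (J1 `|` J2)%fset, (fun i => A J1 A1 i `&` A J2 A2 i); split.
- by move=> i /=; rewrite inE => /orP[/J1K|/J2K].
- by move=> i; apply: measurableI; rewrite /A; case: ifP.
- apply/seteqP; split=> x /=.
    by move=> [h1 h2] i; rewrite /A => _; split; case: ifP => // /[dup]; auto.
  move=> h; split=> i iJ; have := h i; rewrite inE iJ ?orbT /A => /(_ isT)[].
    by rewrite iJ.
  by rewrite iJ.
Qed.

Lemma measurable_coord (K : set nat) (i : nat) : K i ->
  measurable_fun setT (fun x : g_sigma_algebraType (cylinder K) => x i).
Proof.
move=> Ki _ A mA; rewrite setTI; apply: sub_sigma_algebra.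
exists [fset i]%fset, (fun=> A); split => //.
  by move=> j /=; rewrite inE => /eqP ->.
apply/seteqP; split=> x /=; first by move=> ? j; rewrite inE => /eqP ->.
by apply; rewrite inE.
Qed.

Definition sup_partial_sums (l : nat) (x : nat -> R) : \bar R :=
  ereal_sup (range (fun n : nat => (\sum_(l <= i < l + n) x i)%:E)).

Lemma measurable_sup_partial_sums (K : set nat) (l : nat) :
  (forall i, (l <= i)%N -> K i) ->
  measurable_fun setT
    (fun x : g_sigma_algebraType (cylinder K) => sup_partial_sums l x).
Proof.
move=> lK.
pose f n (x : g_sigma_algebraType (cylinder K)) : \bar R :=
  (\sum_(l <= i < l + n) x i)%:E.
rewrite [X in measurable_fun _ X](_ : _ =
    fun x => esups (f ^~ x) 0%N); last first.
  apply/funext => x; rewrite /sup_partial_sums /esups /=; congr ereal_sup.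
  apply/seteqP; split=> _ [n _ <-]; first by exists n.
  by exists n.
apply: measurable_fun_esups => n; apply/measurable_EFinP.
(* [measurable_sum] asks for measurability of every summand, also at indices outside the range;
   those need not lie in [K] and are replaced by 0. *)
rewrite [X in measurable_fun _ X](_ : _ =
    fun x => \sum_(l <= i < l + n) (if (l <= i)%N then x i else 0)); last first.
  by apply/funext => x; apply: eq_big_nat => i /andP[->].
apply: measurable_sum => i; case: (boolP (l <= i)%N) => [/lK Ki|_].
  exact: measurable_coord.
exact: measurable_cst.
Qed.

Lemma measurable_coord_sum (K : set nat) N (A : pred 'I_N) :
  (forall i : 'I_N, A i -> K i) ->
  measurable_fun setT (fun x : g_sigma_algebraType (cylinder K) =>
    \sum_(i < N | A i) x i).
Proof.
move=> AK; rewrite [X in measurable_fun _ X](_ : _ =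
    fun x : g_sigma_algebraType (cylinder K) =>
      \sum_(i < N) (if A i then x i else 0)); last first.
  by apply/funext => x; rewrite big_mkcond.
apply: measurable_sum => i; case: (boolP (A i)) => [/AK Ki|_].
  exact: measurable_coord.
exact: measurable_cst.
Qed.

Context (d : measure_display) (T : measurableType d) (P : probability T R).

(** The sets C satisfying the identity are stable under complements and disjoint countable unions,
    so a generating pi-system suffices. The form serves twice: [phi = psi] yields independence of E,
    and [E = setT] yields equality in law of [phi] and [psi]. *)
Lemma probability_preimage_dynkin d' (S : measurableType d') (G : set (set S))
    (phi psi : T -> S) (E : set T) :
  @measurable _ S = <<s G >> -> setI_closed G ->
  measurable_fun setT phi -> measurable_fun setT psi -> measurable E ->
  (forall C, G C -> P (E `&` phi @^-1` C) = (P E * P (psi @^-1` C))%E) ->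
  forall C, measurable C -> P (E `&` phi @^-1` C) = (P E * P (psi @^-1` C))%E.
Proof.
move=> GE GI mphi mpsi mE PG C mC.
have mph B : measurable B -> measurable (phi @^-1` B).
  by move=> mB; rewrite -[X in measurable X]setTI; exact: mphi.
have mps B : measurable B -> measurable (psi @^-1` B).
  by move=> mB; rewrite -[X in measurable X]setTI; exact: mpsi.
have Pfin A : measurable A -> P A \is a fin_num.
  by move=> mA; exact: fin_num_measure.
apply: (@dynkin_induction _ _ G
  (fun C => P (E `&` phi @^-1` C) = (P E * P (psi @^-1` C))%E)) => //.
- by rewrite !preimage_setT setIT probability_setT mule1.
- move=> B mB PB; rewrite (_ : phi @^-1` (~` B) = ~` (phi @^-1` B))//.
  rewrite (_ : psi @^-1` (~` B) = ~` (psi @^-1` B))// -setDE.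
  rewrite measureD//; [|exact: mph|by rewrite ltey_eq Pfin].
  rewrite probability_setC; last exact: mps.
  rewrite muleBr ?mule1// ?Pfin//; congr (_ - _)%E; exact: PB.
- move=> F mF tF PF; rewrite !preimage_bigcup setI_bigcupr.
  rewrite !measure_bigcup//; last 4 first.
  + by move=> i _; exact: mps.
  + move=> i j _ _ [w [/= wi wj]]; apply: (tF i j) => //.
    by exists (psi w).
  + by move=> i _; apply: measurableI => //; exact: mph.
  + move=> i j _ _ [w [/= [_ wi] [_ wj]]]; apply: (tF i j) => //.
    by exists (phi w).
  rewrite -[P E]fineK ?Pfin// -nneseriesZl// fineK ?Pfin//.
  by apply: eq_eseriesr => i _; exact: PF.
- by rewrite -GE.
Qed.

Context (X : nat -> {RV P >-> R}).

Lemma measurable_sequence (K : set nat) (f : nat -> nat) :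
  measurable_fun setT
    ((fun w i => X (f i) w) : T -> g_sigma_algebraType (cylinder K)).
Proof.
apply: (measurability _ (erefl : @measurable _
  (g_sigma_algebraType (cylinder K)) = <<s cylinder K >>)).
move=> _ [_ [J [A [_ mA ->]] <-]].
rewrite setTI [X in measurable X](_ : _ =
    \bigcap_(i in [set` J]) (X (f i) @^-1` A i)); last first.
  by apply/seteqP; split=> w /= h i iJ; exact: h.
apply: bigcap_measurableType => i _.
by rewrite -[X in measurable X]setTI; exact: measurable_funP.
Qed.

Context (X_indep : mutually_independent X).

Lemma probability_cylinder (J : {fset nat}) (A : nat -> set R) :
  (forall i, measurable (A i)) ->
  P [set w | forall i, i \in J -> A i (X i w)] =
  (\prod_(i <- J) P (X i @^-1` A i))%E.
Proof. by move=> mA; rewrite -X_indep. Qed.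

Lemma independent_of_sequence (K : set nat) (j : nat) d' (S : measurableType d')
    (f : g_sigma_algebraType (cylinder K) -> S) (A : set R) (B : set S) :
  ~ K j -> measurable_fun setT f -> measurable A -> measurable B ->
  P (X j @^-1` A `&` [set w | B (f (fun i => X i w))]) =
  (P (X j @^-1` A) * P [set w | B (f (fun i => X i w))])%E.
Proof.
move=> Kj mf mA mB.
have mPhi := measurable_sequence (K := K) id.
have key := probability_preimage_dynkin
  (S := g_sigma_algebraType (cylinder K)) (E := X j @^-1` A)
  erefl (@setI_closed_cylinder K) mPhi mPhi.
apply: (key _ _ (f @^-1` B)).
- by rewrite -[X in measurable X]setTI; exact: measurable_funP.
- move=> _ [J [A' [JK mA' ->]]].
  have jJ : j \notin J by apply/negP => /JK.
  rewrite /= probability_cylinder//.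
  pose A2 i := if i == j then A else A' i.
  have mA2 i : measurable (A2 i) by rewrite /A2; case: ifP.
  rewrite [X in P X = _](_ : _ =
      [set w | forall i, i \in (j |` J)%fset -> A2 i (X i w)]); last first.
    apply/seteqP; split=> w /=.
      move=> [wj wJ] i; rewrite !inE /A2 => /orP[/eqP -> |iJ].
        by rewrite eqxx.
      by case: eqP => [->//|_]; exact: wJ.
    move=> h; split; first by have := h j; rewrite !inE eqxx /A2 eqxx; exact.
    move=> i iJ; have := h i; rewrite !inE iJ orbT /A2 => /(_ isT).
    by case: eqP => // ij; rewrite ij (negbTE jJ) in iJ.
  rewrite probability_cylinder// big_fsetU1//= /A2 eqxx; congr (_ * _)%E.
  rewrite big_seq [RHS]big_seq; apply: eq_bigr => i iJ.
  by case: eqP => // ij; rewrite ij (negbTE jJ) in iJ.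
- by rewrite -[X in measurable X]setTI; exact: mf.
Qed.

Lemma sequence_shift_stationary (N : nat) d' (S : measurableType d')
    (f : g_sigma_algebraType (cylinder setT) -> S) (B : set S) :
  (forall (k : nat) (A : set R), measurable A ->
    distribution P (X k) A = distribution P (X (k + N)%N) A) ->
  measurable_fun setT f -> measurable B ->
  P [set w | B (f (fun i => X (i + N)%N w))] =
  P [set w | B (f (fun i => X i w))].
Proof.
move=> X_periodic mf mB.
have mPhi := measurable_sequence (K := setT) id.
have mPsi := measurable_sequence (K := setT) (addn^~ N).
rewrite -[LHS]mul1e -(@probability_setT _ _ _ P) -[RHS](congr1 P (setTI _)).
have key := probability_preimage_dynkin
  (S := g_sigma_algebraType (cylinder setT)) (E := setT)
  erefl (@setI_closed_cylinder setT) mPhi mPsi.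
apply/esym; apply: (key _ _ (f @^-1` B)).
- exact: measurableT.
- move=> _ [J [A [_ mA ->]]]; rewrite setTI probability_setT mul1e /=.
  rewrite probability_cylinder//.
  (* A cylinder condition on the shifted sequence is one on the original sequence over the
     translated index set; the factors then agree by periodicity of the marginals. *)
  rewrite [RHS](_ : _ =
      P [set w | forall i, i \in [fset (k + N)%N | k in J]%fset ->
        A (i - N)%N (X i w)]).
    rewrite (@probability_cylinder _ (fun i => A (i - N)%N)) ?big_imfset /=.
    + by apply: eq_bigr => i _; rewrite addnK; exact: X_periodic.
    + by move=> i j _ _ /addIn.
    + by move=> i.
  congr (P _); apply/seteqP; split=> w /=.
    by move=> h _ /imfsetP[k /= kJ ->]; rewrite addnK; exact: h.
  move=> h i iJ; have := h (i + N)%N; rewrite addnK; apply.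
  by apply/imfsetP; exists i.
- by rewrite -[X in measurable X]setTI; exact: mf.
Qed.

End SequenceSpace.

(** * Point masses and generating functions of integer-valued variables that may be +oo *)

Section IntegerValued.
Context (d : measure_display) (T : measurableType d) (R : realType)
  (P : probability T R).
Implicit Types (m : int) (U V : T -> \bar R) (s : R[i]).

Definition ext_int (V : T -> \bar R) :=
  forall w, V w = +oo%E \/ exists k : int, V w = k%:~R%:E.

Lemma measurable_eq_cst V (x : \bar R) :
  measurable_fun setT V -> measurable [set w | V w = x].
Proof.
move=> mV; rewrite [X in measurable X](_ : _ = setT `&` V @^-1` [set x]).
  by apply: mV => //; exact: emeasurable_set1.
by rewrite setTI.
Qed.

Lemma probability_setI_full (A B : set T) : measurable A -> measurable B ->
  P B = 1%E -> P (A `&` B) = P A.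
Proof.
move=> mA mB PB; rewrite -[in RHS](setIT A) -(setUv B) setIUr measureU //.
- rewrite [X in (_ + X)%E](_ : _ = 0%E) ?adde0//; apply/eqP.
  rewrite eq_le measure_ge0 andbT.
  have <- : P (~` B) = 0%E by rewrite probability_setC// PB subee.
  apply: le_measure; rewrite ?inE//; last exact: measurableC.
  by apply: measurableI => //; exact: measurableC.
- exact: measurableI.
- by apply: measurableI => //; exact: measurableC.
- by rewrite setIACA setICr setI0.
Qed.

Lemma sum_int_pmf V m n : measurable_fun setT V ->
  P [set w | exists2 i, (i < n)%N & V w = (m + i%:Z)%:~R%:E]
  = (\sum_(i < n) int_pmf P V (m + i%:Z))%:E.
Proof.
move=> mV; pose E i := [set w | V w = (m + i%:Z)%:~R%:E].
rewrite [X in P X](_ : _ = \big[setU/set0]_(i < n) E i); last first.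
  rewrite -(bigcup_mkord n E).
  by apply/seteqP; split=> w [i /= iN Vw]; exists i.
rewrite measure_bigsetU.
- rewrite -sumEFin; apply: eq_bigr => i _; rewrite fineK// fin_num_measure//.
  exact: measurable_eq_cst.
- by move=> i; exact: measurable_eq_cst.
- move=> i j _ _ [w []]; rewrite /E /= => -> [/eqP].
  by rewrite eqr_int => /eqP /addrI[].
Qed.

Lemma int_pmf_subprob V m : measurable_fun setT V ->
  subprob (fun n => int_pmf P V (m + n%:Z)).
Proof.
move=> mV; split=> n; first by rewrite fine_ge0.
rewrite -lee_fin -sum_int_pmf// probability_le1//.
rewrite [X in measurable X](_ : _ =
  \bigcup_(i in `I_n) [set w | V w = (m + i%:Z)%:~R%:E]); last first.
  by apply/seteqP; split=> w [i /= iN Vw]; exists i.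
by apply: bigcup_measurable => i _; exact: measurable_eq_cst.
Qed.

Lemma measurable_ge_cst V (x : \bar R) :
  measurable_fun setT V -> measurable [set w | (x <= V w)%E].
Proof.
move=> mV; rewrite [X in measurable X](_ : _ = setT `&` V @^-1` `[x, +oo[).
  by apply: mV => //; exact: emeasurable_itv.
by rewrite setTI; apply/seteqP; split=> w /=; rewrite in_itv /= ?andbT.
Qed.

Lemma measurable_le_cst V (x : \bar R) :
  measurable_fun setT V -> measurable [set w | (V w <= x)%E].
Proof.
move=> mV; rewrite [X in measurable X](_ : _ = setT `&` V @^-1` `]-oo, x]).
  by apply: mV => //; exact: emeasurable_itv.
by rewrite setTI; apply/seteqP; split=> w /=; rewrite in_itv.
Qed.

Lemma probability_le_int V m n : measurable_fun setT V -> ext_int V ->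
  P [set w | (m%:~R%:E <= V w)%E] = 1%E ->
  P [set w | (V w <= (m + n%:Z)%:~R%:E)%E] =
  (\sum_(i < n.+1) int_pmf P V (m + i%:Z))%:E.
Proof.
move=> mV Vint Vm; rewrite -sum_int_pmf//.
(* Intersecting with the full event [m <= V] turns the half-line into finitely many atoms. *)
rewrite -(probability_setI_full _ (measurable_ge_cst _ mV) Vm); last first.
  exact: measurable_le_cst.
congr (P _); apply/seteqP; split=> w /=; last first.
  by move=> [i iN ->]; rewrite !lee_fin !ler_int; split; lia.
case: (Vint w) => [->|[k ->]]; first by move=> [].
rewrite !lee_fin !ler_int => -[kn mk]; exists (absz (k - m)); first by lia.
by congr (_%:~R%:E); lia.
Qed.

(** On the full event where both lower bounds hold, the value [m + m' + n] can be split between U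
    and V in only [n.+1] ways. These are the disjoint events [C i]. *)
Lemma int_pmf_add U V m m' n : measurable_fun setT U -> measurable_fun setT V ->
  ext_int U -> ext_int V ->
  P [set w | (m%:~R%:E <= U w)%E] = 1%E ->
  P [set w | (m'%:~R%:E <= V w)%E] = 1%E ->
  (forall a b : int, P ([set w | U w = a%:~R%:E] `&` [set w | V w = b%:~R%:E])
     = (P [set w | U w = a%:~R%:E] * P [set w | V w = b%:~R%:E])%E) ->
  int_pmf P (fun w => U w + V w)%E (m + m' + n%:Z) =
  conv (fun n => int_pmf P U (m + n%:Z)) (fun n => int_pmf P V (m' + n%:Z)) n.
Proof.
move=> mU mV Uint Vint Um Vm UV.
have mS : measurable_fun setT (fun w => U w + V w)%E by exact: emeasurable_funD.
pose C i := [set w | U w = (m + i%:Z)%:~R%:E] `&`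
            [set w | V w = (m' + (n%:Z - i%:Z))%:~R%:E].
have mC i : measurable (C i).
  by apply: measurableI; exact: measurable_eq_cst.
rewrite {1}/int_pmf.
rewrite -(probability_setI_full _ (measurable_ge_cst _ mU) Um); last first.
  exact: measurable_eq_cst.
rewrite -(probability_setI_full _ (measurable_ge_cst _ mV) Vm); last first.
  by apply: measurableI; [exact: measurable_eq_cst|exact: measurable_ge_cst].
rewrite [X in P X](_ : _ = \big[setU/set0]_(i < n.+1) C i); last first.
  rewrite -(bigcup_mkord n.+1 C); apply/seteqP; split=> w /=.
    (* An infinite summand makes the sum +oo, which is no integer; only the case of two integers
       survives. *)
    case: (Uint w) (Vint w) => [Uk|[k Uk]] [Vl|[l Vl]]; rewrite Uk Vl //=;
      try by move=> [[]].
    move=> -[[[/eqP +]]]; rewrite -rmorphD eqr_int => /eqP kl.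
    rewrite !lee_fin !ler_int => mk ml.
    exists (absz (k - m)) => /=; first by lia.
    by split; rewrite /= ?Uk ?Vl; congr (_%:~R%:E); lia.
  move=> [i /= iN []]; rewrite /= => -> ->.
  rewrite -EFinD -rmorphD !lee_fin !ler_int.
  by split; [split; [congr (_%:~R%:E)|]|]; lia.
rewrite measure_bigsetU//; last first.
  move=> i j _ _ [w [[Ui _] [Uj _]]]; move: Ui Uj => /= -> [/eqP].
  by rewrite eqr_int => /eqP /addrI[].
rewrite -sum_fine; last by move=> i _; rewrite fin_num_measure.
apply: eq_bigr => i _.
rewrite -[LHS]/(fine (P (C i))) UV fineM ?fin_num_measure//.
- by rewrite subzn// -ltnS.
- exact: measurable_eq_cst.
- exact: measurable_eq_cst.
Qed.

(** Factoring out [s ^ m] leaves natural exponents only, so the power series results above apply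
    even for negative [m]. *)
Lemma pgfE m V s : s != 0 -> `|s| < 1 -> measurable_fun setT V ->
  pgf P m V s = s ^ m * psum s (fun n => int_pmf P V (m + n%:Z)).
Proof.
move=> s0 s1 mV; rewrite /pgf /psum.
rewrite -limn_mull; last exact: is_cvg_psum s1 (int_pmf_subprob m mV).
apply: (congr1 (fun u : nat -> R[i]^o => limn u)).
apply/funext => n; rewrite /series /= mulr_sumr; apply: eq_bigr => i _.
by rewrite expfzDr// -exprnP mulrA.
Qed.

Lemma ext_intD U V : ext_int U -> ext_int V -> ext_int (fun w => U w + V w)%E.
Proof.
move=> Ui Vi w; case: (Ui w) => [->|[k ->]]; case: (Vi w) => [->|[l ->]]; auto.
by right; exists (k + l); rewrite -EFinD rmorphD.
Qed.

Lemma ge_intD U V m m' : measurable_fun setT U -> measurable_fun setT V ->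
  P [set w | (m%:~R%:E <= U w)%E] = 1%E ->
  P [set w | (m'%:~R%:E <= V w)%E] = 1%E ->
  P [set w | ((m + m')%:~R%:E <= U w + V w)%E] = 1%E.
Proof.
move=> mU mV Um Vm; apply/eqP; rewrite eq_le probability_le1 /=; last first.
  by apply: measurable_ge_cst; exact: emeasurable_funD.
rewrite -{1}Vm.
rewrite -(probability_setI_full _ (measurable_ge_cst _ mU) Um); last first.
  exact: measurable_ge_cst.
apply: le_measure; rewrite ?inE.
- by apply: measurableI; exact: measurable_ge_cst.
- by apply: measurable_ge_cst; exact: emeasurable_funD.
- by move=> w [/= h1 h2]; rewrite rmorphD EFinD leeD.
Qed.

Lemma pgf_add U V m m' s : s != 0 -> `|s| < 1 ->
  measurable_fun setT U -> measurable_fun setT V ->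
  ext_int U -> ext_int V ->
  P [set w | (m%:~R%:E <= U w)%E] = 1%E ->
  P [set w | (m'%:~R%:E <= V w)%E] = 1%E ->
  (forall a b : int, P ([set w | U w = a%:~R%:E] `&` [set w | V w = b%:~R%:E])
     = (P [set w | U w = a%:~R%:E] * P [set w | V w = b%:~R%:E])%E) ->
  pgf P (m + m') (fun w => U w + V w)%E s = pgf P m U s * pgf P m' V s.
Proof.
move=> s0 s1 mU mV Ui Vi Um Vm UV.
have mS : measurable_fun setT (fun w => U w + V w)%E by exact: emeasurable_funD.
rewrite !pgfE// expfzDr// mulrACA -psum_conv//; [|exact: int_pmf_subprob..|].
  congr (_ * psum s _); apply/funext => n; exact: int_pmf_add.
(* The convolution is a subprobability because it is the law of U + V. *)
have := int_pmf_subprob (m + m') mS.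
by rewrite (_ : (fun n => _) = conv (fun n => int_pmf P U (m + n%:Z))
  (fun n => int_pmf P V (m' + n%:Z)))//; apply/funext => n; exact: int_pmf_add.
Qed.

End IntegerValued.

(** * Splitting off initial terms, and summation by parts *)

Lemma limn_series_split (K : numFieldType) (u : nat -> K) (a : nat) :
  cvgn (series (fun n => u (a + n)%N) : nat -> K^o) ->
  limn (series u : nat -> K^o) =
  \sum_(i < a) u i + limn (series (fun n => u (a + n)%N) : nat -> K^o).
Proof.
move=> cu; apply: (@cvg_lim K^o) => //.
rewrite -(cvg_shiftn a) /=.
rewrite [X in X @ _ --> _](_ : _ =
    fun n => \sum_(i < a) u i + series (fun n => u (a + n)%N) n).
  by apply: (@cvgD _ K^o) => //; exact: cvg_cst.
apply/funext => n; rewrite series_addn seriesEord /=; congr (_ + _).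
rewrite -{1}(add0n a) big_addn addnK /series /=.
by apply: eq_bigr => i _; rewrite addnC.
Qed.

Section Psum.
Context (R : realType).
Implicit Types (s : R[i]) (p : nat -> R).

Lemma subprob_shift p a : subprob p -> subprob (fun n => p (a + n)%N).
Proof.
move=> [p0 p1]; split=> n; first exact: p0.
apply: le_trans (p1 (a + n)%N); rewrite big_split_ord /=.
by rewrite lerDr sumr_ge0.
Qed.

Lemma psum_split s p a : `|s| < 1 -> subprob p ->
  psum s p = \sum_(i < a) s ^+ i * (p i)%:C +
             s ^+ a * psum s (fun n => p (a + n)%N).
Proof.
move=> s1 hp; have cp := is_cvg_psum s1 (subprob_shift a hp).
rewrite {2}/psum -limn_mull//.
have E : (fun n => s ^+ a * series (fun k => s ^+ k * (p (a + k)%N)%:C) n) =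
    series (fun n => s ^+ (a + n) * (p (a + n)%N)%:C).
  apply/funext => n; rewrite /series /= mulr_sumr; apply: eq_bigr => i _.
  by rewrite exprD mulrA.
rewrite E; apply: (limn_series_split (u := fun n => s ^+ n * (p n)%:C)).
rewrite -[X in cvgn X]E; exact: is_cvgn_mull.
Qed.

End Psum.

Section Abel.
Context (F : comRingType).

(** Here [c] is geometric, so consecutive weights [1 - c i] differ by a multiple of [s - 1]. It is
    later applied with [c b = 1], where the boundary term vanishes. *)
Lemma sum_by_parts (s : F) (c z : nat -> F) (b : nat) :
  (forall n, (n < b)%N -> c n.+1 = s * c n) ->
  \sum_(i < b) (1 - c i) * z i =
  (s - 1) * (\sum_(i < b) c i * \sum_(k < i.+1) z k) +
  (1 - c b) * \sum_(k < b) z k.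
Proof.
elim: b => [|b IH] cS; first by rewrite !big_ord0 !mulr0 addr0.
rewrite !(big_ord_recr b) /= IH; last by move=> n nb; apply: cS; exact: ltnW.
by rewrite ?(big_ord_recr b) /= cS//; ring.
Qed.

End Abel.

(** Cumulating a convolution amounts to cumulating one factor: this is how the distribution function
    of X_j enters B_j. *)
Lemma sum_conv (R : realType) (a b : nat -> R) (n : nat) :
  \sum_(l < n.+1) conv a b l = conv a (fun k => \sum_(i < k.+1) b i) n.
Proof.
elim: n => [|n IH]; first by rewrite big_ord1 /conv !big_ord1.
rewrite big_ord_recr /= IH /conv.
rewrite [in RHS]big_ord_recr /= subnn big_ord1.
rewrite [X in _ + X]big_ord_recr /= subnn.
rewrite addrA -big_split /=; congr (_ + _); apply: eq_bigr => i _.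
by rewrite -mulrDr subSn ?leq_ord// [in RHS]big_ord_recr.
Qed.

(** * Generating function of max(0, V) *)

Section Max0.
Context (d : measure_display) (T : measurableType d) (R : realType)
  (P : probability T R).
Implicit Types (m : int) (V : T -> \bar R) (s : R[i]).

Lemma int_pmf_eq0 V m k : measurable_fun setT V ->
  P [set w | (m%:~R%:E <= V w)%E] = 1%E -> k < m -> int_pmf P V k = 0.
Proof.
move=> mV Vm km; rewrite /int_pmf.
rewrite -(probability_setI_full _ (measurable_ge_cst _ mV) Vm); last first.
  exact: measurable_eq_cst.
rewrite [X in P X](_ : _ = set0) ?measure0//.
apply/seteqP; split=> // w [/= ->]; rewrite lee_fin ler_int => mk.
by have := lt_le_trans km mk; rewrite ltxx.
Qed.

Lemma pgf_lower V m (a : nat) s : s != 0 -> `|s| < 1 -> measurable_fun setT V ->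
  P [set w | (m%:~R%:E <= V w)%E] = 1%E ->
  pgf P (m - a%:Z) V s = pgf P m V s.
Proof.
move=> s0 s1 mV Vm.
rewrite !pgfE// (psum_split a)//; last exact: int_pmf_subprob.
rewrite big1 ?add0r; last first.
  move=> i _; rewrite (int_pmf_eq0 mV Vm) ?mulr0//.
  by have := ltn_ord i; lia.
rewrite mulrA exprnP -expfzDr// subrK; congr (_ * psum s _).
by apply/funext => n; congr int_pmf; lia.
Qed.

(** Taking the maximum moves each atom at k < 0 to 0, which replaces its weight [s ^ k] by 1. *)
Lemma pgf_max0 V (a : nat) s : s != 0 -> `|s| < 1 ->
  measurable_fun setT V -> ext_int V ->
  P [set w | ((- a%:Z)%:~R%:E <= V w)%E] = 1%E ->
  pgf P 0 (fun w => maxe 0%:E (V w)) s = pgf P (- a%:Z) V s +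
   \sum_(i < a) (1 - s ^ (- a%:Z + i%:Z)) * (int_pmf P V (- a%:Z + i%:Z))%:C.
Proof.
move=> s0 s1 mV Vi Va.
have mW : measurable_fun setT (fun w => maxe 0%:E (V w)).
  by apply: measurable_maxe => //; exact: measurable_cst.
rewrite !pgfE// expr0z mul1r.
(* Both series are cut just after the value 0: after 1 term for the maximum, after [a.+1] terms for
   V, which starts at -a. The tails carry the values at least 1, where the two variables agree. *)
rewrite (psum_split 1)//; last exact: int_pmf_subprob.
rewrite [in RHS](psum_split a.+1)//; last exact: int_pmf_subprob.
rewrite big_ord1 expr0 mul1r expr1 add0r.
have -> : int_pmf P (fun w => maxe 0%:E (V w)) 0 =
    \sum_(i < a.+1) int_pmf P V (- a%:Z + i%:Z).
  rewrite -[RHS]/(fine _%:E) -probability_le_int// /int_pmf.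
  congr (fine (P _)); apply/seteqP; split=> w /=; rewrite addNr.
    by move=> <-; rewrite le_max lexx orbT.
  by move=> V0; apply/max_idPl.
have -> : (fun n => int_pmf P (fun w => maxe 0%:E (V w)) (0 + (1 + n)%N%:Z)) =
   (fun n => int_pmf P V (- a%:Z + (a.+1 + n)%N%:Z)).
  apply/funext => n; rewrite /int_pmf; congr (fine (P _)).
  have -> : - a%:Z + (a.+1 + n)%N%:Z = n.+1%:Z by lia.
  apply/seteqP; split=> w /=; rewrite add0r add1n.
    rewrite /maxe; case: ifP => // _ [/eqP]; by rewrite eq_sym pnatr_eq0.
  move=> ->; apply/max_idPr; by rewrite lee_fin ler0z.
rewrite mulrDr mulrA exprnP -expfzDr//.
have -> : - a%:Z + a.+1%:Z = 1 by lia.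
rewrite expr1z addrAC; congr (_ + _).
rewrite mulr_sumr rmorph_sum /= !big_ord_recr /= exprnP mulrA -expfzDr// addNr.
rewrite expr0z mul1r addrAC; congr (_ + _).
rewrite -big_split /=; apply: eq_bigr => i _.
by rewrite mulrA exprnP -expfzDr// mulrBl mul1r addrC subrK.
Qed.

End Max0.

(** * Solving a first-order linear recurrence around a cycle *)

Section CyclicRecurrence.
Context (F : comRingType) (N : nat) (N_gt0 : (0 < N)%N).

Lemma recurrence_iter (g G B : nat -> F) (c : F) :
  (forall k, G k = g k * G k.+1 + c * B k) -> forall j n,
  G j = (\prod_(j <= i < j + n) g i) * G (j + n)%N +
        c * \sum_(j <= r < j + n) (\prod_(j <= i < r) g i) * B r.
Proof.
move=> GE j; elim=> [|n IH].
  by rewrite addn0 !big_geq// mul1r mulr0 addr0.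
rewrite addnS !big_nat_recr ?leq_addr//= {1}IH {1}GE; ring.
Qed.

Lemma prod_ord_nat (g : nat -> F) (a b : nat) : (b <= N)%N ->
  \prod_(i < N | (a <= i < b)%N) g i = \prod_(a <= i < b) g i.
Proof.
move=> bN; rewrite -(big_mkord (fun i => (a <= i < b)%N) g).
by rewrite [RHS](big_nat_widenl a 0)// (big_nat_widen 0 b N).
Qed.

(** Reduction mod N extends functions on the cycle to periodic ones on [nat], so that cyclic
    products become products over intervals. *)
Let idx (k : nat) : 'I_N := Ordinal (ltn_pmod k N_gt0).

Let idx_ord (i : 'I_N) : idx i = i.
Proof. by apply: val_inj => /=; rewrite modn_small. Qed.

(** After N steps from j the periodic extension is back at j, and every index of the cycle has been
    met once. *)
Lemma cyclic_recurrence (g G B : 'I_N -> F) (c : F) :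
  (forall j, G j = g j * G (ordS j) + c * B j) -> forall j,
  G j = (\prod_i g i) * G j + c * \sum_r
    (if j == r then 1
     else if (j < r)%N then \prod_(i : 'I_N | (j <= i < r)%N) g i
     else \prod_(i : 'I_N | (i < r)%N || (j <= i)%N) g i) * B r.
Proof.
move=> GE j; pose g' := g \o idx; pose B' := B \o idx; pose G' := G \o idx.
have G'E k : G' k = g' k * G' k.+1 + c * B' k.
  rewrite /G' /= GE; congr (_ * G _ + _); apply: val_inj => /=.
  by rewrite -addn1 modnDml addn1.
have per (a : nat) : \prod_(N <= i < N + a) g' i = \prod_(0 <= i < a) g' i.
  rewrite -{1}(add0n N) big_addn addKn; apply: eq_bigr => i _.
  by rewrite /g' /=; congr g; apply: val_inj => /=; rewrite modnDr.
have gE : \prod_i g i = \prod_(j <= i < j + N) g' i.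
  rewrite (@big_cat_nat _ _ _ N)//= ?leq_addl//; last exact: ltnW.
  rewrite addnC per mulrC -big_cat_nat//=; last exact: ltnW.
  by rewrite big_mkord; apply: eq_bigr => i _; rewrite /g' /= idx_ord.
have GNj : G' (j + N)%N = G j.
  rewrite /G' /=; congr G; apply: val_inj => /=.
  by rewrite modnDr modn_small.
have := recurrence_iter G'E j N; rewrite {1}/G' /= idx_ord GNj -gE => {1}->.
congr (_ + c * _).
rewrite (@big_cat_nat _ _ _ N)//= ?leq_addl//; last exact: ltnW.
have shift (f : nat -> F) :
    \sum_(N <= i < j + N) f i = \sum_(0 <= i < j) f (i + N)%N.
  by rewrite -{1}(add0n N) big_addn addnK.
rewrite shift addrC.
(* An index r < j is met as r + N; the interval from j to r + N, cut at N, consists of the i with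
   [j <= i] and, after wrapping, those with [i < r]. *)
rewrite (eq_bigr (fun r : 'I_N => (if (j <= r)%N then \prod_(j <= i < r) g' i
  else \prod_(j <= i < r + N) g' i) * B' r)); last first.
  move=> r _; congr (_ * _); last by rewrite /B' /= idx_ord.
  have gidx (A : pred 'I_N) : \prod_(i | A i) g i = \prod_(i | A i) g' i.
    by apply: eq_bigr => i _; rewrite /g' /= idx_ord.
  rewrite !gidx; case: eqVneq => [<-|jr]; first by rewrite leqnn big_geq.
  rewrite [(j <= r)%N]leq_eqVlt (_ : (j == r :> nat) = false) /=; last first.
    by apply/negbTE; apply: contraNneq jr => /val_inj ->.
  case: ltnP => [jltr|rj]; first by rewrite prod_ord_nat// ltnW.
  rewrite (@big_cat_nat _ _ _ N)//= ?leq_addl//; last exact: ltnW.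
  rewrite addnC per (bigID (fun i : 'I_N => (i < r)%N)) /= mulrC.
  rewrite -!prod_ord_nat//; last exact: ltnW.
  congr (_ * _); apply: eq_bigl => i; have := ltn_ord i; lia.
rewrite -(big_mkord predT (fun r : nat =>
  (if (j <= r)%N then \prod_(j <= i < r) g' i
   else \prod_(j <= i < r + N) g' i) * B' r)).
rewrite [RHS](@big_cat_nat _ _ _ j)//=; last exact: ltnW.
congr (_ + _); apply: eq_big_nat => r.
  move=> /andP[_ rj]; rewrite leqNgt rj /=; congr (_ * B _).
  by apply: val_inj => /=; rewrite modnDr.
by move=> /andP[-> _].
Qed.

End CyclicRecurrence.

(** * Recursion and integrality of the supremum of partial sums *)

Section SupPartialSums.
Context (R : realType).
Implicit Types (x : nat -> R) (l : nat).

Lemma sup_partial_sums_ge0 l x : (0%:E <= sup_partial_sums l x)%E.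
Proof.
by apply: ereal_sup_ubound; exists 0%N => //; rewrite addn0 big_geq.
Qed.

(** Every nonempty partial sum from l is [x l] plus a partial sum from [l.+1]; the empty one
    accounts for the 0. *)
Lemma sup_partial_sums_rec l x :
  sup_partial_sums l x = maxe 0%:E (sup_partial_sums l.+1 x + (x l)%:E)%E.
Proof.
have step n : \sum_(l <= i < l + n.+1) x i =
    \sum_(l.+1 <= i < l.+1 + n) x i + x l.
  by rewrite addnS big_nat_recl ?leq_addr// addrC big_add1 addSn.
apply/eqP; rewrite eq_le; apply/andP; split.
  apply: ge_ereal_sup => _ [n _ <-]; rewrite le_max.
  case: n => [|n]; first by rewrite addn0 big_geq// lexx.
  rewrite step EFinD; apply/orP; right; apply: leeD2r.
  by apply: ereal_sup_ubound; exists n.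
rewrite ge_max sup_partial_sums_ge0 /= -leeBrDr//.
apply: ge_ereal_sup => _ [n _ <-]; rewrite leeBrDr//.
by rewrite -EFinD -step; apply: ereal_sup_ubound; exists n.+1.
Qed.

(** A finite supremum is attained: some integer partial sum k exceeds it minus 1, hence all the
    others, being integers below k + 1, are at most k. *)
Lemma sup_partial_sums_int l x : (forall i, x i \is a Num.int) ->
  sup_partial_sums l x = +oo%E \/
  exists k : int, sup_partial_sums l x = k%:~R%:E.
Proof.
move=> xint; have S0 := sup_partial_sums_ge0 l x.
case E : (sup_partial_sums l x) S0 => [r| |//]; last by left.
move=> r0; right.
have [_ [n _ <-] rn] : exists2 y : \bar R,
    range (fun n : nat => (\sum_(l <= i < l + n) x i)%:E) y &
    ((r - 1)%:E < y)%E.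
  apply: ereal_sup_gt; rewrite -/(sup_partial_sums l x) E.
  by rewrite lte_fin ltrBlDr ltrDl.
have sint a : \sum_(l <= i < l + a) x i \is a Num.int by rewrite rpred_sum.
have /intrP[k kE] := sint n; exists k.
rewrite kE lte_fin in rn.
apply/eqP; rewrite -E eq_le; apply/andP; split; last first.
  by rewrite -kE; apply: ereal_sup_ubound; exists n.
apply: ge_ereal_sup => _ [a _ <-].
have /intrP[k' k'E] := sint a.
have : ((\sum_(l <= i < l + a) x i)%:E <= r%:E)%E.
  by rewrite -E; apply: ereal_sup_ubound; exists a.
rewrite k'E !lee_fin => k'r.
rewrite ler_int -ltzD1 -(ltr_int R) intrD.
by rewrite (le_lt_trans k'r)// -ltrBlDr.
Qed.

End SupPartialSums.

(** * The walk: independence, generating functions of block sums, and the recurrence for the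
    maxima *)

Section PeriodicWalk.
Context (d : measure_display) (T : measurableType d) (R : realType)
  (P : probability T R) (N : nat) (X : nat -> {RV P >-> R}) (m : 'I_N -> int).
Context (X_int : forall (k : nat) (w : T), X k w \is a Num.int).
Context (X_indep : mutually_independent X).
Context (X_ge : forall j : 'I_N, P [set w | (m j)%:~R <= X j w] = 1%E).
Context (s : R[i]) (s_lt1 : `|s| < 1) (s_neq0 : s != 0).

Lemma measurable_walk_max j : measurable_fun setT (walk_max X j).
Proof.
have mS := @measurable_sup_partial_sums R setT j (fun _ _ => I).
exact: measurableT_comp mS (measurable_sequence X (K := setT) id).
Qed.

Lemma ext_int_walk_max j : ext_int (walk_max X j).
Proof. by move=> w; apply: (sup_partial_sums_int j) => i; exact: X_int. Qed.

Lemma walk_max_ge0 j : P [set w | ((0 : int)%:~R%:E <= walk_max X j w)%E] = 1%E.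
Proof.
rewrite [X in P X](_ : _ = setT) ?probability_setT//.
by apply/seteqP; split=> // w _; exact: sup_partial_sums_ge0.
Qed.

Lemma ext_int_RV j : ext_int (EFin \o X j).
Proof.
by move=> w; right; have /intrP[k kE] := X_int j w; exists k; rewrite /= kE.
Qed.

Lemma measurable_RV j : measurable_fun setT (EFin \o X j).
Proof. by apply/measurable_EFinP; exact: measurable_funP. Qed.

Lemma RV_ge (j : 'I_N) : P [set w | ((m j)%:~R%:E <= (EFin \o X j) w)%E] = 1%E.
Proof. by rewrite -(X_ge j); congr (P _); apply/seteqP; split. Qed.

Lemma eq_RVE (j : nat) (a : int) :
  [set w | (EFin \o X j) w = a%:~R%:E] = X j @^-1` [set a%:~R].
Proof. by apply/seteqP; split=> w /=; [case | exact: (congr1 EFin)]. Qed.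

Lemma walk_max_indep (j : nat) (a b : int) :
  P ([set w | walk_max X j.+1 w = a%:~R%:E] `&`
     [set w | (EFin \o X j) w = b%:~R%:E]) =
  (P [set w | walk_max X j.+1 w = a%:~R%:E] *
   P [set w | (EFin \o X j) w = b%:~R%:E])%E.
Proof.
rewrite eq_RVE setIC muleC.
apply: (independent_of_sequence X_indep (K := [set i | (j < i)%N])
  (f := sup_partial_sums j.+1) (B := [set a%:~R%:E])).
- by rewrite /= ltnn.
- exact: measurable_sup_partial_sums.
- exact: measurable_set1.
- exact: emeasurable_set1.
Qed.

Lemma period_sum_indep (A : pred 'I_N) (j : 'I_N) (a b : int) : ~~ A j ->
  P ([set w | (EFin \o X j) w = a%:~R%:E] `&`
     [set w | (EFin \o period_sum X A) w = b%:~R%:E]) =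
  (P [set w | (EFin \o X j) w = a%:~R%:E] *
   P [set w | (EFin \o period_sum X A) w = b%:~R%:E])%E.
Proof.
move=> Aj; rewrite eq_RVE.
have mS : measurable_fun setT (fun x : g_sigma_algebraType
    (cylinder (R := R) (~` [set val j])) => \sum_(i < N | A i) x i).
  apply: measurable_coord_sum => i Ai /= /val_inj ij.
  by rewrite -ij Ai in Aj.
have -> : [set w | (EFin \o period_sum X A) w = b%:~R%:E] =
  [set w | [set b%:~R] (\sum_(i < N | A i) X i w)].
  by apply/seteqP; split=> w /=; [case | exact: (congr1 EFin)].
apply: (independent_of_sequence X_indep (K := ~` [set val j])
  (f := fun x => \sum_(i < N | A i) x i)) => //.
by move=> /=; apply.
Qed.

Lemma measurable_period_sum (A : pred 'I_N) :
  measurable_fun setT (EFin \o period_sum X A).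
Proof.
apply/measurable_EFinP.
have mS := @measurable_coord_sum R setT N A (fun _ _ => I).
exact: measurableT_comp mS (measurable_sequence X (K := setT) id).
Qed.

Lemma ext_int_period_sum (A : pred 'I_N) : ext_int (EFin \o period_sum X A).
Proof.
move=> w; right.
have /intrP[k kE] : period_sum X A w \is a Num.int.
  by rewrite rpred_sum// => i _; exact: X_int.
by exists k; rewrite /= kE.
Qed.

(** Splitting off the first term shows that the value is fixed by multiplication by [s], and [s]
    differs from 1. *)
Lemma psum0 : psum s (fun=> 0 : R) = 0.
Proof.
have h0 : subprob (fun=> 0 : R) by split=> n //; rewrite big1.
have := psum_split 1 s_lt1 h0; rewrite big_ord1 mulr0 add0r expr1.
move=> /eqP; rewrite -subr_eq0 -{1}[psum _ _]mul1r -mulrBl mulf_eq0.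
case/orP => [|/eqP//]; rewrite subr_eq0 => /eqP s1.
by move: s_lt1; rewrite -s1 normr1 ltxx.
Qed.

Lemma pgf_cst0 : pgf P 0 (fun=> 0%:E) s = 1.
Proof.
have m0 : measurable_fun setT (fun _ : T => 0%:E : \bar R).
  by exact: measurable_cst.
rewrite pgfE// expr0z mul1r (psum_split 1)//; last exact: int_pmf_subprob.
rewrite big_ord1 expr0 mul1r expr1.
rewrite (_ : (fun n => _) = fun=> 0).
  rewrite psum0 mulr0 addr0 /int_pmf (_ : [set _ | _] = setT).
    by rewrite probability_setT.
  by apply/seteqP; split.
apply/funext => n; rewrite /int_pmf (_ : [set _ | _] = set0) ?measure0//.
apply/seteqP; split=> // w /= [] /eqP; rewrite add0r add1n.
by rewrite eq_sym pnatr_eq0.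
Qed.

(** Both claims go through one induction on the size of A: removing an index, the product formula
    [pgf_add] needs the lower bound for the remaining sum. *)
Lemma period_sumP (A : pred 'I_N) :
  P [set w | ((\sum_(i < N | A i) m i)%:~R%:E <=
              (EFin \o period_sum X A) w)%E] = 1%E /\
  G_period_sum X m A s = \prod_(i < N | A i) pgf P (m i) (EFin \o X i) s.
Proof.
have [n] := ubnP #|A|; elim: n A => // n IH A An.
have [j Aj|A0] := pickP A; last first.
  rewrite /G_period_sum !(big_pred0 _ _ _ _ A0).
  rewrite (_ : EFin \o _ = fun=> 0%:E); last first.
    by apply/funext => w; rewrite /= /period_sum big_pred0.
  rewrite pgf_cst0; split=> //.
  rewrite (_ : [set _ | _] = setT) ?probability_setT//.
  by apply/seteqP; split=> // w _; exact: lexx.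
pose A' := [pred i | A i && (i != j)].
have A'j : ~~ A' j by rewrite /= eqxx andbF.
have A'n : (#|A'| < n)%N.
  rewrite ltnS in An; apply: leq_trans An; apply: proper_card.
  apply/fintype.properP; split; first by apply/fintype.subsetP => i /andP[].
  by exists j => //; exact: A'j.
have [IH1 IH2] := IH _ A'n.
have SE : (EFin \o period_sum X A) =
    (fun w => (EFin \o X j) w + (EFin \o period_sum X A') w)%E.
  by apply/funext => w /=; rewrite /period_sum (bigD1 j).
rewrite /G_period_sum SE (bigD1 j)// [\prod_(i < N | A i) _](bigD1 j)//; split.
  apply: ge_intD => //; [exact: measurable_RV|exact: measurable_period_sum|].
  exact: RV_ge.
rewrite pgf_add//; first by congr (_ * _).
- exact: measurable_RV.
- exact: measurable_period_sum.
- exact: ext_int_RV.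
- exact: ext_int_period_sum.
- exact: RV_ge.
- by move=> a b; exact: period_sum_indep.
Qed.

Lemma RV_ge_sub (j : 'I_N) (b : nat) :
  P [set w | ((m j - b%:Z)%:~R%:E <= (EFin \o X j) w)%E] = 1%E.
Proof.
have mge (k : int) : measurable [set w | (k%:~R%:E <= (EFin \o X j) w)%E].
  by apply: measurable_ge_cst; exact: measurable_RV.
apply/eqP; rewrite eq_le probability_le1//= -(RV_ge j).
apply: le_measure; rewrite ?inE//.
by move=> w /=; apply: le_trans; rewrite lee_fin ler_int lerBlDr lerDl.
Qed.

Lemma cdf_RV (j : 'I_N) (b t : nat) :
  fine (cdf (X j) (m j - b%:Z + t%:Z)%:~R) =
  \sum_(i < t.+1) int_pmf P (EFin \o X j) (m j - b%:Z + i%:Z).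
Proof.
rewrite -[RHS]/(fine _%:E) -probability_le_int//.
- exact: measurable_RV.
- exact: ext_int_RV.
- exact: RV_ge_sub.
Qed.

Lemma pi_period (k : nat) :
  (forall (k : nat) (A : set R), measurable A ->
    distribution P (X k) A = distribution P (X (k + N)%N) A) ->
  pi_ X N k = pi_ X 0 k.
Proof.
move=> X_periodic; rewrite /pi_ /int_pmf; congr fine.
have walk_maxN w : walk_max X N w = sup_partial_sums 0 (fun i => X (i + N)%N w).
  rewrite /walk_max /sup_partial_sums.
  apply: (congr1 (fun f : nat -> \bar R => ereal_sup (range f))).
  by apply/funext => n; rewrite -{1}(add0n N) big_addn addKn.
rewrite (_ : [set w | walk_max X N w = _] =
    [set w | [set k%:~R%:E] (sup_partial_sums 0 (fun i => X (i + N)%N w))]).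
  apply: (sequence_shift_stationary X_indep (f := sup_partial_sums 0)
    (B := [set k%:~R%:E]) X_periodic).
    by apply: measurable_sup_partial_sums.
  exact: emeasurable_set1.
by apply/seteqP; split=> w /=; rewrite walk_maxN.
Qed.

Lemma sum_int_rangeN (a : nat) (f : int -> R[i]) :
  \sum_(k <- int_range (- a%:Z) 0) f k = \sum_(i < a) f (- a%:Z + i%:Z).
Proof.
rewrite /int_range big_map.
have -> : absz (Num.max 0 (0 - - a%:Z)) = a by lia.
by rewrite -{1}(subn0 a) -[iota 0 _]/(index_iota 0 a) big_mkord.
Qed.

Lemma pgf_walk_max (j : 'I_N) :
  pgf P 0 (walk_max X j) s =
  pgf P (m j) (EFin \o X j) s * pgf P 0 (walk_max X j.+1) s +
  (s - 1) * \sum_(k <- int_range (m j) 0)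
    s ^ k * (\sum_(0 <= i < (absz (k - m j)).+1)
               pi_ X j.+1 i * fine (cdf (X j) (k - i%:Z)%:~R))%:C.
Proof.
(* a and b are the negative and positive parts of [m j]. Lowering the bound by b gives X_j the bound
   -a <= 0 whatever the sign of [m j], as [pgf_max0] requires. *)
have [a [b [abE ab0]]] : exists a b : nat,
    m j - b%:Z = - a%:Z /\ (a = 0%N /\ 0 <= m j \/ b = 0%N).
  case: (m j) => n; first by exists 0%N, n; split; [lia | left].
  by exists n.+1, 0%N; split; [lia | right].
have mX := measurable_RV j; have Xi := ext_int_RV j.
have mM := measurable_walk_max j.+1; have Mi := ext_int_walk_max j.+1.
have M0 := walk_max_ge0 j.+1.
have Xa := RV_ge_sub j b; rewrite abE in Xa.
have MX := walk_max_indep j.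
pose Z w := (walk_max X j.+1 w + (EFin \o X j) w)%E.
have mZ : measurable_fun setT Z by exact: emeasurable_funD.
have Zi : ext_int Z by exact: ext_intD.
have Za : P [set w | ((- a%:Z)%:~R%:E <= Z w)%E] = 1%E.
  by rewrite -[- a%:Z]add0r; exact: ge_intD.
have -> : walk_max X j = fun w => maxe 0%:E (Z w).
  apply/funext => w; rewrite /walk_max -/(sup_partial_sums j _).
  exact: sup_partial_sums_rec.
rewrite (pgf_max0 s_neq0 s_lt1 mZ Zi Za).
have -> : pgf P (- a%:Z) Z s =
    pgf P 0 (walk_max X j.+1) s * pgf P (- a%:Z) (EFin \o X j) s.
  by rewrite -[in LHS](add0r (- a%:Z)); exact: pgf_add.
rewrite -abE (pgf_lower b s_neq0 s_lt1 mX (RV_ge j)) mulrC abE.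
congr (_ + _).
(* The weights run from [s ^ (- a)] up to [s ^ 0 = 1], so there is no boundary term. *)
rewrite (sum_by_parts (s := s) (c := fun i => s ^ (- a%:Z + i%:Z))
  (fun i => (int_pmf P Z (- a%:Z + i%:Z))%:C)); last first.
  move=> n _ /=; rewrite -[X in _ = X * _]expr1z -expfzDr//; congr (s ^ _); lia.
rewrite addNr expr0z subrr mul0r addr0; congr (_ * _).
have {}abE : a = 0%N /\ 0 <= m j \/ b = 0%N /\ m j = - a%:Z.
  by case: ab0 abE => [|->]; [left | rewrite subr0; right].
(* For [0 <= m j] both sums are empty; otherwise the cumulated masses of Z are matched with the
   inner sums of B_j. *)
case: abE => [[-> mj0]|[b0 mja]].
  rewrite big_ord0 /int_range (_ : absz _ = 0%N) ?big_nil//; lia.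
rewrite mja sum_int_rangeN; apply: eq_bigr => i _; congr (_ * _).
rewrite -rmorph_sum /=; congr (_%:C).
have zE n : int_pmf P Z (- a%:Z + n%:Z) =
    conv (fun n => int_pmf P (walk_max X j.+1) (0 + n%:Z))
         (fun n => int_pmf P (EFin \o X j) (- a%:Z + n%:Z)) n.
  by rewrite -[- a%:Z in LHS]add0r; exact: int_pmf_add.
under eq_bigr => n _ do rewrite zE.
rewrite sum_conv /conv.
have -> : - a%:Z + i%:Z - (- a%:Z) = i%:Z by lia.
rewrite absz_nat.
rewrite big_mkord; apply: eq_bigr => k _; rewrite /pi_ add0r; congr (_ * _).
have -> : - a%:Z + i%:Z - k%:Z = m j - 0%:Z + (i - k)%N%:Z.
  by have := ltn_ord k; rewrite mja; lia.
by rewrite cdf_RV subr0 mja.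
Qed.

End PeriodicWalk.

Theorem proposition1 (R : realType) (d : measure_display)
  (T : measurableType d) (P : probability T R)
  (N : nat) (X : nat -> {RV P >-> R}) (m : 'I_N -> int)
  (N_gt0 : (0 < N)%N)
  (X_int : forall (k : nat) (w : T), X k w \is a Num.int)
  (X_indep : mutually_independent X)
  (X_periodic : forall (k : nat) (A : set R), measurable A ->
    distribution P (X k) A = distribution P (X (k + N)%N) A)
  (X_atom : forall j : 'I_N, (0 < P [set w | X j w = (m j)%:~R])%E)
  (X_ge : forall j : 'I_N, P [set w | (m j)%:~R <= X j w] = 1%E)
  (D_lt0 : \sum_(j < N) m j < 0)
  (ES_lt0 : ('E_P[period_sum X (@predT 'I_N)] < 0)%E)
  (s : R[i]) (s_lt1 : `|s| < 1) (s_neq0 : s != 0)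
  (GS_neq1 : G_S X m s != 1) :
  (1 - s)^-1 *: G_max N X s = (G_S X m s - 1)^-1 *: (M_mx X m s *m B_vec X m s).
Proof.
have GA A := (period_sumP X_int X_indep X_ge s_lt1 s_neq0 A).2.
(* The cyclic successor differs from [j.+1] only at the last index, where the starts N and 0 are
   exchanged by periodicity. *)
have walkN (j : 'I_N) k : pi_ X (ordS j) k = pi_ X j.+1 k.
  rewrite /ordS /=; have [jN|jN] := ltnP j.+1 N; first by rewrite modn_small.
  have -> : j.+1 = N by apply/eqP; rewrite eqn_leq jN ltn_ord.
  by rewrite modnn pi_period.
have pgfN (j : 'I_N) :
    pgf P 0 (walk_max X (ordS j)) s = pgf P 0 (walk_max X j.+1) s.
  rewrite !pgfE//; [|exact: measurable_walk_max..]; congr (_ * psum s _).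
  by apply/funext => n; rewrite add0r; exact: walkN.
pose G j := G_max N X s j 0; pose B j := B_vec X m s j 0.
have rec j : G j = pgf P (m j) (EFin \o X j) s * G (ordS j) + (s - 1) * B j.
  rewrite /G /B !mxE (pgf_walk_max X_int X_indep X_ge)// pgfN.
  congr (_ + _ * _).
  apply: eq_bigr => k _; congr (_ * _%:C); apply: eq_bigr => i _.
  by rewrite walkN.
apply/matrixP => j i; rewrite ord1 [LHS]mxE [RHS]mxE [in RHS]mxE -/(G j).
have := cyclic_recurrence N_gt0 rec j.
set A := \sum_(r < N) _.
have -> : \sum_(r < N) M_mx X m s j r * B_vec X m s r 0 = A.
  apply: eq_bigr => r _; congr (_ * _); rewrite mxE; case: ifP => // _.
  by case: ifP => _; rewrite GA.
rewrite -[\prod_i _](GA predT) -/(G_S X m s) => GE.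
have s1 : 1 - s != 0.
  apply: contraTneq s_lt1 => /eqP; rewrite subr_eq0 => /eqP <-.
  by rewrite normr1 ltxx.
have GS1 : G_S X m s - 1 != 0 by rewrite subr_eq0.
(* Clearing the two nonzero denominators leaves the relation GE obtained from one turn around the
   cycle. *)
apply: (mulfI s1); rewrite mulrA divff// mul1r; apply: (mulfI GS1).
rewrite mulrCA [X in _ = _ * X]mulrA divff// mul1r.
by rewrite mulrBl mul1r {2}GE opprD addNKr -mulNr opprB.
Qed.
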